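(* Let $m\ge 0$, $q\ge 1$ be integers with $m+q\ge 2$, and let $\mathcal{A}$ be any left $\mathbb{D}C_{m,q}$-module. Then $$\mathrm{H}^0(C_{m,q},\mathcal{A})\cong \mathcal{A}^{\mathrm S}(0),$$ and, for any integer $r\geq 0$, $$\mathrm{H}^{2r+1}(C_{m,q},\mathcal{A})\cong \frac{\mathcal{A}^{\mathrm T}((r\cdot m)\oplus 1)}{\mathcal{A}_{\mathrm S}(r\cdot m)},\qquad \mathrm{H}^{2r+2}(C_{m,q},\mathcal{A})\cong \frac{\mathcal{A}^{\mathrm S}((r+1)\cdot m)}{\mathcal{A}_{\mathrm T}((r\cdot m)\oplus 1)}.$$
   Context: **Cyclic monoids.** $\mathbb{N}=\{0,1,\dots\}$. For $m\ge 0$, $q\ge 1$, the cyclic monoid $C_{m,q}$ of index $m$ and period $q$ is the set $\{0,1,\dots,m+q-1\}$ with addition $x\oplus y=\wp(x+y)$, where $\wp:\mathbb{N}\to C_{m,q}$ is given by $\wp(x)=x$ if $x<m+q$ and, for $x\ge m$, $\wp(x)$ is the unique element of $\{m,\dots,m+q-1\}$ congruent to $x$ modulo $q$. For $r\in\mathbb{N}$ and $x\in C_{m,q}$, $r\cdot x=x\oplus\cdots\oplus x$ ($r$ times) $=\wp(rx)$. It is assumed that $m+q\ge 2$. **The category $\mathbb{D}M$ and left modules.** For a monoid $M$ (written additively), $\mathbb{D}M$ is the category with object set $M$ and arrow set $M\times M\times M$, where $(x,y,z):y\to x+y+z$; composition is $(u,x+y+z,v)(x,y,z)=(u+x,y,z+v)$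 and the identity of $x$ is $(0,x,0)$. A left $\mathbb{D}M$-module is a functor $\mathcal{A}:\mathbb{D}M\to\mathbf{Ab}$; morphisms are natural transformations. Write $x_*=\mathcal{A}(x,y,0):\mathcal{A}(y)\to\mathcal{A}(x+y)$ and $y^*=\mathcal{A}(0,x,y):\mathcal{A}(x)\to\mathcal{A}(x+y)$, so $\mathcal{A}(x,y,z)=x_*z^*=z^*x_*$. **Leech cohomology.** $\mathrm{H}^n(M,\mathcal{A})=\mathrm{Ext}^n_{\mathbb{D}M}(\mathbb{Z},\mathcal{A})$, the Ext groups in the abelian category of left $\mathbb{D}M$-modules, where $\mathbb{Z}$ is the constant functor with value $\mathbb{Z}$ (all maps identities). **The maps $\mathrm S$ and $\mathrm T$.** Let $\mathcal{A}$ be a left $\mathbb{D}C_{m,q}$-module. For $x\in C_{m,q}$, $\mathrm S:\mathcal{A}(x)\to\mathcal{A}(x\oplus 1)$ is $\mathrm S(a)=1_*a-1^*a$. For $x\in C_{m,q}$ with $x\ge 1$, the trace map $\mathrm T:\mathcal{A}(x)\to\mathcal{A}(m\oplus(x-1))$ is $$\mathrm T(a)=\sum_{t=0}^{m+q-1}t^*(m+q-t-1)_*a-\sum_{s=0}^{m-1}s^*(m-s-1)_*a.$$ Put $\mathcal{A}^{\mathrm T}(x)=\{a\in\mathcal{A}(x)\mid \mathrm T(a)=0\}$, $\mathcal{A}_{\mathrm T}(x)=\{\mathrm T(a)\mid a\in\mathcal{A}(x)\}\subseteq\mathcal{A}(m\oplus(x-1))$, $\mathcal{A}^{\mathrm S}(x)=\{a\in\mathcal{A}(x)\mid\mathrm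 S(a)=0\}$, $\mathcal{A}_{\mathrm S}(x)=\{\mathrm S(a)\mid a\in\mathcal{A}(x)\}\subseteq\mathcal{A}(x\oplus 1)$. *)

(* Defs.v *)
From HB Require Import structures.
From mathcomp Require Import all_boot all_order all_algebra.
From mathcomp Require Import boolp.
From mathcomp Require Import freeg zify.

Set Implicit Arguments.
Unset Strict Implicit.
Unset Printing Implicit Defensive.
Import GRing.Theory.
Local Open Scope ring_scope.

Definition zmod_isom (U V : zmodType) : Prop :=
  exists f : {additive U -> V}, bijective f.

Section Subgroups.
Variables U V : zmodType.

Definition kerp (f : {additive U -> V}) : {pred U} := [pred x | f x == 0].

Definition imp (f : {additive U -> V}) : {pred V} :=
  [pred y | `[< exists x, f x = y >]].

Lemma kerp_zmod_closed (f : {additive U -> V}) : zmod_closed (kerp f).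
Proof.
split=> [|x y]; first by rewrite inE raddf0.
by rewrite !inE raddfB => /eqP-> /eqP->; rewrite subr0.
Qed.

Lemma imp_zmod_closed (f : {additive U -> V}) : zmod_closed (imp f).
Proof.
split=> [|_ _ /asboolP[x <-] /asboolP[y <-]]; apply/asboolP.
  by exists 0; rewrite raddf0.
by exists (x - y); rewrite raddfB.
Qed.

HB.instance Definition _ f :=
  GRing.isZmodClosed.Build U (kerp f) (kerp_zmod_closed f).
HB.instance Definition _ f :=
  GRing.isZmodClosed.Build V (imp f) (imp_zmod_closed f).
End Subgroups.

Definition subg (V : zmodType) (K : zmodClosed V) := {x : V | x \in K}.
HB.instance Definition _ V K := [isSub of @subg V K for sval].
HB.instance Definition _ V K := [Choice of @subg V K by <:].
HB.instance Definition _ V K := [SubChoice_isSubZmodule of @subg V K by <:].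

Section Subquotient.
Variables (V : zmodType) (K I : zmodClosed V).

Definition relp : {pred subg K} := [pred x | \val x \in I].

Lemma relp_zmod_closed : zmod_closed relp.
Proof.
split=> [|x y]; first by rewrite inE raddf0 rpred0.
by rewrite !inE raddfB => Ix Iy; rewrite rpredB.
Qed.
HB.instance Definition _ :=
  GRing.isZmodClosed.Build (subg K) relp relp_zmod_closed.

(* The quotient [K / I]; only used when [I] is contained in [K]. *)
Definition subquot : zmodType := {ideal_quot relp}.
End Subquotient.

Section DModules.
(* DM makes sense for any monoid; only the commutative case is used here. *)
Variable M : nmodType.

(* The triples (u, y, v) with u + y + v = z, that is, the arrows y -> z. *)
Definition darr (y z : M) := {p : M * M | p.1 + y + p.2 == z}.

Definition mkarr (u v y z : M) (e : u + y + v = z) : darr y z :=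
  exist _ (u, v) (introT eqP e).

Lemma darr_id_subproof (x : M) : 0 + x + 0 = x.
Proof. by rewrite add0r addr0. Qed.

Definition darr_id (x : M) : darr x x := mkarr (darr_id_subproof x).

Lemma darr_comp_subproof (x y z : M) (g : darr y z) (f : darr x y) :
  (\val g).1 + (\val f).1 + x + ((\val f).2 + (\val g).2) = z.
Proof.
case: g f => [[u v] /= /eqP <-] [[s t] /= /eqP <-].
by rewrite !addrA.
Qed.

Definition darr_comp (x y z : M) (g : darr y z) (f : darr x y) : darr x z :=
  mkarr (darr_comp_subproof g f).

Record dmodule := DModule {
  dobj :> M -> zmodType;
  dact : forall y z, darr y z -> {additive dobj y -> dobj z};
  dact_id : forall x (a : dobj x), dact (darr_id x) a = a;
  dact_comp : forall x y z (g : darr y z) (f : darr x y) (a : dobj x),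
    dact (darr_comp g f) a = dact g (dact f a) }.

Record dmor (A B : dmodule) := DMor {
  dmor_fun :> forall x, {additive A x -> B x};
  dmor_nat : forall y z (f : darr y z) (a : A y),
    dmor_fun z (dact A f a) = dact B f (dmor_fun y a) }.

Lemma additive_inj (U V : zmodType) (f g : {additive U -> V}) :
  f =1 g -> f = g.
Proof.
case: f g => [f [[pf]]] [g [[pg]]] /= /funext efg; subst g.
by rewrite (Prop_irrelevance pf pg).
Qed.

Lemma dmor_inj (A B : dmodule) (f g : dmor A B) :
  (forall x (a : A x), f x a = g x a) -> f = g.
Proof.
case: f g => [f pf] [g pg] /= efg.
have eqfg : f = g.
  by apply: functional_extensionality_dep => x; apply: additive_inj => a; exact: efg.
by subst g; rewrite (Prop_irrelevance pf pg).
Qed.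

Section Hom.
Variables A B : dmodule.

HB.instance Definition _ := gen_eqMixin (dmor A B).
HB.instance Definition _ := gen_choiceMixin (dmor A B).

Definition dmor_zero : dmor A B.
Proof.
by exists (fun x => (\0 : A x -> B x)) => y z f a; rewrite /= raddf0.
Defined.

Definition dmor_opp (f : dmor A B) : dmor A B.
Proof.
by exists (fun x => \- f x) => y z g a; rewrite /= dmor_nat raddfN.
Defined.

Definition dmor_add (f g : dmor A B) : dmor A B.
Proof.
by exists (fun x => f x \+ g x) => y z h a; rewrite /= !dmor_nat raddfD.
Defined.

Lemma dmor_addA : associative dmor_add.
Proof. by move=> f g h; apply: dmor_inj => x a; apply: addrA. Qed.
Lemma dmor_addC : commutative dmor_add.
Proof. by move=> f g; apply: dmor_inj => x a; apply: addrC. Qed.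
Lemma dmor_add0 : left_id dmor_zero dmor_add.
Proof. by move=> f; apply: dmor_inj => x a; apply: add0r. Qed.
Lemma dmor_addN : left_inverse dmor_zero dmor_opp dmor_add.
Proof. by move=> f; apply: dmor_inj => x a; apply: addNr. Qed.

HB.instance Definition _ :=
  GRing.isZmodule.Build (dmor A B) dmor_addA dmor_addC dmor_add0 dmor_addN.
End Hom.

Definition dmor_comp (A B C : dmodule) (g : dmor B C) (f : dmor A B) :
  dmor A C.
Proof.
by exists (fun x => g x \o f x) => y z h a; rewrite /= !dmor_nat.
Defined.

Definition precomp (A B C : dmodule) (f : dmor A B) (g : dmor B C) :
  dmor A C := dmor_comp g f.

Lemma precomp_zmod_morphism (A B C : dmodule) (f : dmor A B) :
  zmod_morphism (@precomp A B C f).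
Proof. by move=> g h; apply: dmor_inj => x a. Qed.

HB.instance Definition _ A B C f := GRing.isZmodMorphism.Build
  (dmor B C) (dmor A C) (@precomp A B C f) (@precomp_zmod_morphism A B C f).

(* In a category of functors to abelian groups, epimorphisms and exactness
   are detected objectwise. *)
Definition dsurj (A B : dmodule) (f : dmor A B) : Prop :=
  forall x (b : B x), exists a, f x a = b.

Definition dexact (A B C : dmodule) (f : dmor A B) (g : dmor B C) : Prop :=
  forall x (b : B x), g x b = 0 <-> exists a, f x a = b.

Definition projective (P : dmodule) : Prop :=
  forall (B C : dmodule) (e : dmor B C) (f : dmor P C),
    dsurj e -> exists g : dmor P B, dmor_comp e g = f.

Record proj_resolution (B : dmodule) := ProjResolution {
  res :> nat -> dmodule;
  res_d : forall n, dmor (res n.+1) (res n);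
  res_aug : dmor (res 0) B;
  res_proj : forall n, projective (res n);
  res_surj : dsurj res_aug;
  res_exact0 : dexact (res_d 0) res_aug;
  res_exactS : forall n, dexact (res_d n.+1) (res_d n) }.

Section Ext.
Variables (B : dmodule) (P : proj_resolution B) (A : dmodule).

Definition cobd (n : nat) : {additive dmor (P n) A -> dmor (P n.+1) A} :=
  precomp (res_d P n).

(* The differential arriving in degree [n]; it is zero when [n] is 0. *)
Definition cobd_in (n : nat) : {additive dmor (P n.-1) A -> dmor (P n) A} :=
  match n with 0 => \0 | k.+1 => cobd k end.

Lemma cobd_in_sub n : {subset imp (cobd_in n) <= kerp (cobd n)}.
Proof.
move=> _ /asboolP[f <-]; rewrite inE; apply/eqP/dmor_inj => x a.
case: n f a => [//|n] f a /=.
have /res_exactS -> : exists c, res_d P n.+1 x c = res_d P n.+1 x a.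
  by exists a.
by rewrite raddf0.
Qed.

(* [Ext^n(B, A)], computed from the projective resolution [P] of [B]. *)
Definition Ext (n : nat) : zmodType :=
  subquot (kerp (cobd n)) (imp (cobd_in n)).
End Ext.

Definition const_int : dmodule.
Proof. by exists (fun=> int) (fun _ _ _ => idfun). Defined.

Definition leech_cohomology (P : proj_resolution const_int) (n : nat)
  (A : dmodule) : zmodType := Ext P A n.

Section FreeLift.
Variables (K : choiceType) (V : zmodType).

Definition flift (f : K -> V) (D : {freeg K / int}) : V :=
  fglift (f : K -> zmodule V) D.

Lemma flift_zmod_morphism f : zmod_morphism (flift f).
Proof. exact: (@lift_is_additive int K (zmodule V) f). Qed.
HB.instance Definition _ f := GRing.isZmodMorphism.Build
  {freeg K / int} V (flift f) (flift_zmod_morphism f).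

Lemma fliftU f k : flift f << k >> = f k.
Proof. by rewrite /flift liftU scale1r. Qed.

Lemma free_ext (g h : {additive {freeg K / int} -> V}) :
  (forall k, g << k >> = h << k >>) -> g =1 h.
Proof.
move=> egh D; rewrite -(freeg_sumE D) !raddf_sum; apply: eq_bigr => k _.
have -> : << coeff k D *g k >> = << k >> *~ coeff k D by rewrite freegU_mulz intz.
by rewrite !raddfMz egh.
Qed.
End FreeLift.

Section Free.
Variable B : dmodule.

Definition fgen (y : M) : choiceType := {x : M & (B x * darr x y)%type}.

Definition fgen_act (y z : M) (g : darr y z) (k : fgen y) : fgen z :=
  Tagged (fun x => (B x * darr x z)%type)
    ((tagged k).1, darr_comp g (tagged k).2).

Definition free_obj (y : M) : zmodType := {freeg (fgen y) / int}.

Definition free_act (y z : M) (g : darr y z) :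
    {additive free_obj y -> free_obj z} :=
  flift (fun k => << fgen_act g k >> : free_obj z).

Lemma darr_id_comp (x y : M) (f : darr x y) : darr_comp (darr_id y) f = f.
Proof.
by apply: val_inj; rewrite /= add0r addr0 -surjective_pairing.
Qed.

Lemma darr_comp_id (x y : M) (f : darr x y) : darr_comp f (darr_id x) = f.
Proof.
by apply: val_inj; rewrite /= addr0 add0r -surjective_pairing.
Qed.

Lemma darr_compA (w x y z : M) (h : darr y z) (g : darr x y) (f : darr w x) :
  darr_comp (darr_comp h g) f = darr_comp h (darr_comp g f).
Proof. by apply: val_inj; rewrite /= !addrA. Qed.

Definition free_mod : dmodule.
Proof.
exists free_obj free_act.
- move=> x a; apply: (free_ext (g := free_act _) (h := idfun)) => -[w [b f]].
  by rewrite /= fliftU /fgen_act /= darr_id_comp.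
- move=> x y z g f a.
  apply: (free_ext (g := free_act _) (h := free_act g \o free_act f)).
  by move=> -[w [b h]]; rewrite /= !fliftU /fgen_act /= darr_compA.
Defined.

Definition free_cover_fun (y : M) : {additive free_obj y -> B y} :=
  flift (fun k : fgen y => dact B (tagged k).2 (tagged k).1).

Definition free_cover : dmor free_mod B.
Proof.
exists free_cover_fun => y z g a.
apply: (free_ext (g := free_cover_fun z \o free_act g)
                 (h := dact B g \o free_cover_fun y)) => -[w [b f]].
by rewrite /= !fliftU /= dact_comp.
Defined.

Lemma free_cover_surj : dsurj free_cover.
Proof.
move=> x b; exists << Tagged (fun w => (B w * darr w x)%type) (b, darr_id x) >>.
by rewrite /= fliftU dact_id.
Qed.

Lemma free_mod_projective : projective free_mod.
Proof.
move=> C D e h e_surj.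
pose gen x (b : B x) : free_mod x :=
  << Tagged (fun w => (B w * darr w x)%type) (b, darr_id x) >>.
pose lft x (b : B x) := sval (cid (e_surj x (h x (gen x b)))).
have lftP x b : e x (lft x b) = h x (gen x b).
  by rewrite /lft; case: cid.
pose g y : {additive free_mod y -> C y} :=
  flift (fun k : fgen y => dact C (tagged k).2 (lft _ (tagged k).1)).
have g_nat y z (f : darr y z) (a : free_mod y) :
    g z (dact free_mod f a) = dact C f (g y a).
  apply: (free_ext (g := g z \o free_act f) (h := dact C f \o g y)).
  by move=> -[w [b k]]; rewrite /= /g !fliftU /= dact_comp.
exists (DMor g_nat); apply: dmor_inj => y a /=.
apply: (free_ext (g := e y \o g y) (h := h y)) => -[w [b f]].
rewrite /= /g fliftU /= dmor_nat lftP -dmor_nat; congr (h y _).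
by rewrite /= fliftU /fgen_act /= darr_comp_id.
Qed.
End Free.

Section Kernel.
Variables (A B : dmodule) (e : dmor A B).

Definition ker_obj (x : M) : zmodType := subg (kerp (e x)).

Lemma ker_act_subproof y z (f : darr y z) (a : ker_obj y) :
  dact A f (\val a) \in kerp (e z).
Proof.
have := valP a; rewrite !inE => /eqP ea.
by rewrite dmor_nat ea raddf0.
Qed.

Definition ker_fun y z (f : darr y z) (a : ker_obj y) : ker_obj z :=
  exist _ (dact A f (\val a)) (ker_act_subproof f a).

Lemma ker_fun_zmod_morphism y z (f : darr y z) : zmod_morphism (ker_fun f).
Proof. by move=> a b; apply: val_inj; rewrite /= !raddfB. Qed.
HB.instance Definition _ y z f := GRing.isZmodMorphism.Build
  (ker_obj y) (ker_obj z) (@ker_fun y z f) (@ker_fun_zmod_morphism y z f).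

Definition ker_mod : dmodule.
Proof.
exists ker_obj (fun y z f => ker_fun f).
- by move=> x a; apply: val_inj; rewrite /= dact_id.
- by move=> x y z g f a; apply: val_inj; rewrite /= dact_comp.
Defined.

Definition ker_incl : dmor ker_mod A.
Proof. by exists (fun x => \val : {additive ker_obj x -> A x}). Defined.
End Kernel.

Section FreeResolution.
Variable B : dmodule.

Fixpoint syzygy (n : nat) : dmodule :=
  if n is k.+1 then ker_mod (free_cover (syzygy k)) else B.

Lemma free_res_exact (A C : dmodule) (e : dmor A C) :
  dexact (dmor_comp (ker_incl e) (free_cover (ker_mod e))) e.
Proof.
move=> x b; split=> [eb|[a <-]]; last first.
  by have := valP (free_cover (ker_mod e) x a); rewrite inE => /eqP.
have kb : b \in kerp (e x) by rewrite inE eb.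
have [a ea] := @free_cover_surj (ker_mod e) x (exist _ b kb).
by exists a => /=; rewrite ea.
Qed.

Lemma dexact_comp_inj (A C D E : dmodule) (f : dmor A C) (g : dmor C D)
    (i : dmor D E) :
  (forall x, injective (i x)) -> dexact f g -> dexact f (dmor_comp i g).
Proof.
move=> inj_i fg x b; rewrite -(fg x b) /=.
by split=> [|->]; [rewrite -[RHS](raddf0 (i x)) => /inj_i | rewrite raddf0].
Qed.

Definition free_resolution : proj_resolution B.
Proof.
exists (fun n => free_mod (syzygy n))
  (fun n => dmor_comp (ker_incl _) (free_cover (syzygy n.+1)))
  (free_cover B).
- by move=> n; apply: free_mod_projective.
- exact: free_cover_surj.
- exact: free_res_exact.
- move=> n; apply: dexact_comp_inj; last exact: free_res_exact.
  by move=> x; apply: val_inj.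
Defined.
End FreeResolution.

Section Star.
Variable A : dmodule.

Lemma lstar_subproof (u x y : M) : u + x = y -> u + x + 0 = y.
Proof. by rewrite addr0. Qed.

(* This is u_*, and [rstar] is v^*. *)
Definition lstar (u x y : M) (e : u + x = y) : {additive A x -> A y} :=
  dact A (mkarr (lstar_subproof e)).

Lemma rstar_subproof (v x y : M) : x + v = y -> 0 + x + v = y.
Proof. by rewrite add0r. Qed.

Definition rstar (v x y : M) (e : x + v = y) : {additive A x -> A y} :=
  dact A (mkarr (rstar_subproof e)).
End Star.

End DModules.

Definition cyc (m q : nat) (q_gt0 : (0 < q)%N) := 'I_(m + q).
HB.instance Definition _ m q q_gt0 := Finite.on (@cyc m q q_gt0).

Section Cyclic.
Variables (m q : nat) (q_gt0 : (0 < q)%N).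
Local Notation C := (cyc m q_gt0).

(* The projection from nat onto the cyclic monoid; see [wpn_mod]. *)
Definition wpn (x : nat) : nat :=
  if (x < m + q)%N then x else (m + (x - m) %% q)%N.

Lemma wpn_lt x : (wpn x < m + q)%N.
Proof. by rewrite /wpn; case: ifP => // _; rewrite ltn_add2l ltn_pmod. Qed.

Definition wp (x : nat) : C := Ordinal (wpn_lt x).

Lemma wpnE x : (m <= x)%N -> wpn x = (m + (x - m) %% q)%N.
Proof.
move=> mx; rewrite /wpn; case: ifP => // lt_x.
by rewrite modn_small ?subnKC //; lia.
Qed.

Lemma wpn_mod x : (m <= x)%N -> (m <= wpn x)%N /\ wpn x = x %[mod q].
Proof.
move=> mx; rewrite wpnE // leq_addr; split=> //.
by rewrite modnDmr subnKC.
Qed.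

Lemma wpn_small x : (x < m + q)%N -> wpn x = x.
Proof. by rewrite /wpn => ->. Qed.

Lemma wpn_eq x y : (m <= x)%N -> (m <= y)%N -> x = y %[mod q] -> wpn x = wpn y.
Proof.
move=> mx my exy; rewrite !wpnE //; congr addn.
by apply/eqP; rewrite -(eqn_modDl m) !subnKC //; apply/eqP.
Qed.

Lemma wpnDl x y : wpn (wpn x + y) = wpn (x + y).
Proof.
have [lt_x|le_x] := ltnP x (m + q); first by rewrite (wpn_small lt_x).
have mx : (m <= x)%N by apply: leq_trans le_x; apply: leq_addr.
have [mw ew] := wpn_mod mx.
apply: wpn_eq; try by apply: leq_trans (leq_addr _ _).
by rewrite -[LHS]modnDml ew modnDml.
Qed.

Lemma wpnDr x y : wpn (x + wpn y) = wpn (x + y).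
Proof. by rewrite addnC wpnDl addnC. Qed.

Definition cyc_add (x y : C) : C := wp (x + y).

Lemma cyc_addA : associative cyc_add.
Proof. by move=> x y z; apply: val_inj; rewrite /= wpnDl wpnDr addnA. Qed.
Lemma cyc_addC : commutative cyc_add.
Proof. by move=> x y; apply: val_inj; rewrite /= addnC. Qed.
Lemma cyc_add0 : left_id (wp 0) cyc_add.
Proof. by move=> x; apply: val_inj; rewrite /= wpnDl wpn_small ?ltn_ord. Qed.

HB.instance Definition _ :=
  GRing.isNmodule.Build C cyc_addA cyc_addC cyc_add0.

Lemma wpD x y : wp x + wp y = wp (x + y).
Proof. by apply: val_inj; rewrite /= wpnDl wpnDr. Qed.

Lemma wp_val (x : C) : wp x = x.
Proof. by apply: val_inj; rewrite /= wpn_small ?ltn_ord. Qed.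

Lemma wp_mulrn x r : wp x *+ r = wp (r * x).
Proof. by elim: r => [//|r IHr]; rewrite mulrS IHr wpD mulSn. Qed.

Lemma wp_period x : (m <= x)%N -> wp (q + x) = wp x.
Proof.
move=> mx; apply/val_inj/wpn_eq => //; first exact: leq_trans (leq_addl _ _).
by rewrite modnDl.
Qed.

Section SandT.
Variable A : dmodule C.

Definition Smap (x : C) (a : A x) : A (x + wp 1) :=
  lstar A (addrC (wp 1) x) a - rstar A (erefl (x + wp 1)) a.

Lemma Smap_zmod_morphism x : zmod_morphism (@Smap x).
Proof. by move=> a b; rewrite /Smap !raddfB addrACA. Qed.
HB.instance Definition _ x :=
  GRing.isZmodMorphism.Build (A x) (A (x + wp 1)) (@Smap x)
    (@Smap_zmod_morphism x).

Section Trace.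
(* The target m (+) (x - 1) of the trace map is a variable [y], so that it can
   be any object equal to that one. *)
Variables (x y : C) (x_gt0 : (0 < x)%N) (y_def : y = wp m + wp x.-1).

Lemma trace_subproof1 (t : 'I_(m + q)) :
  (wp (m + q - t - 1) + x) + wp t = y.
Proof.
rewrite y_def -[X in _ + X + _]wp_val !wpD.
have -> : (m + q - t - 1 + x + t = q + (m + x.-1))%N.
  by have := ltn_ord t; lia.
by rewrite wp_period ?leq_addr.
Qed.

Lemma trace_subproof2 (s : 'I_m) : (wp (m - s - 1) + x) + wp s = y.
Proof.
rewrite y_def -[X in _ + X + _]wp_val !wpD; congr wp.
by have := ltn_ord s; lia.
Qed.

Definition Tmap (a : A x) : A y :=
  \sum_(t < m + q) rstar A (trace_subproof1 t)
                     (lstar A (erefl (wp (m + q - t - 1) + x)) a)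
  - \sum_(s < m) rstar A (trace_subproof2 s)
                   (lstar A (erefl (wp (m - s - 1) + x)) a).

Lemma Tmap_zmod_morphism : zmod_morphism Tmap.
Proof.
move=> a b; rewrite /Tmap.
under eq_bigr do rewrite !raddfB.
under [X in _ - X]eq_bigr do rewrite !raddfB.
by rewrite !sumrB !opprD addrACA.
Qed.
HB.instance Definition _ :=
  GRing.isZmodMorphism.Build (A x) (A y) Tmap Tmap_zmod_morphism.
End Trace.

Definition invS (x : C) : zmodClosed (A x) := kerp (@Smap x).

Definition imS (x : C) : zmodClosed (A (x + wp 1)) := imp (@Smap x).

Definition invT (x : C) (x_gt0 : (0 < x)%N) : zmodClosed (A x) :=
  kerp (Tmap x_gt0 erefl).

Definition imT (x y : C) (x_gt0 : (0 < x)%N) (y_def : y = wp m + wp x.-1) :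
  zmodClosed (A y) := imp (Tmap x_gt0 y_def).

(* The action of the arrow (wp k, x, wp l) from x to z, if there is one. *)
Definition pact (x z : C) (k l : nat) (a : A x) : A z :=
  if insub (wp k, wp l) is Some f then dact A (f : darr x z) a else 0.

Lemma pactE (x z : C) (k l : nat) (f : darr x z) (a : A x) :
  \val f = (wp k, wp l) -> dact A f a = pact z k l a.
Proof. by move=> ef; rewrite /pact -ef valK. Qed.

Lemma pact_telescope (x z : C) (n : nat) (a : A x) :
  \sum_(t < n) (pact z (n - t) t a - pact z (n - t - 1) t.+1 a)
  = pact z n 0 a - pact z 0 n a.
Proof.
have -> : pact z n 0 a - pact z 0 n a
    = - pact z (n - n) n a - - pact z (n - 0) 0 a.
  by rewrite subnn subn0 opprK addrC.
rewrite -(telescope_sumr (fun t => - pact z (n - t) t a) (leq0n n)) big_mkord.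
by apply: eq_bigr => t _; rewrite opprK addrC -subnDA addn1.
Qed.

Lemma pact_cancel (x z : C) (a : A x) :
  \sum_(t < m + q)
     (pact z (m + q - t) t a - pact z (m + q - t - 1) t.+1 a)
  - \sum_(s < m) (pact z (m - s) s a - pact z (m - s - 1) s.+1 a) = 0.
Proof.
by rewrite !pact_telescope /pact addnC wp_period // subrr.
Qed.

Lemma imS_sub_invT x (x_gt0 : (0 < (x + wp 1)%R)%N) :
  {subset imS x <= invT x_gt0}.
Proof.
move=> _ /asboolP[a <-]; rewrite inE; apply/eqP.
rewrite -[RHS](pact_cancel (wp m + wp (x + wp 1)%R.-1) a) /= /Tmap /Smap.
congr (_ - _); apply: eq_bigr => t _; rewrite !raddfB -!dact_comp;
  congr (_ - _); apply: pactE; congr (_, _);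
  rewrite /= ?(add0r, addr0) ?wpD //; congr wp; have := ltn_ord t; lia.
Qed.

Lemma imT_sub_invS (x y : C) (x_gt0 : (0 < x)%N) (y_def : y = wp m + wp x.-1) :
  {subset imT x_gt0 y_def <= invS y}.
Proof.
move=> _ /asboolP[a <-]; rewrite inE; apply/eqP.
rewrite -[RHS](pact_cancel (y + wp 1) a) /= /Tmap.
rewrite (raddfB (@Smap y)) !(raddf_sum (@Smap y)).
congr (_ - _); apply: eq_bigr => t _; rewrite /= /Smap -!dact_comp;
  congr (_ - _); apply: pactE; congr (_, _);
  rewrite /= ?(add0r, addr0) ?wpD //; congr wp; have := ltn_ord t; lia.
Qed.
End SandT.

Section Objects.
Hypothesis mq_ge2 : (2 <= m + q)%N.

Lemma mulm_add1_gt0 r : (0 < (wp m *+ r + wp 1)%R)%N.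
Proof.
rewrite wp_mulrn wpD /=.
have [lt_n|le_n] := ltnP (r * m + 1) (m + q); first by rewrite wpn_small // addn1.
have m_gt0 : (0 < m)%N by rewrite lt0n; apply/eqP => m0; move: le_n; rewrite m0; lia.
have [le_m _] := @wpn_mod (r * m + 1) (leq_trans (leq_addr _ _) le_n).
exact: leq_trans le_m.
Qed.

Lemma mulmS_def r :
  wp m *+ r.+1 = wp m + wp ((wp m *+ r + wp 1)%R : C).-1.
Proof.
rewrite !wp_mulrn !wpD /=; apply: val_inj => /=.
have [lt_n|le_n] := ltnP (r * m + 1) (m + q).
  by rewrite (wpn_small lt_n) addn1 mulSn.
have m_gt0 : (0 < m)%N by rewrite lt0n; apply/eqP => m0; move: le_n; rewrite m0; lia.
have [le_m eq_m] := @wpn_mod (r * m + 1) (leq_trans (leq_addr _ _) le_n).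
apply: wpn_eq; rewrite ?leq_addr //; apply/eqP.
rewrite -(eqn_modDr 1) mulSn -addnA -modnDmr -eq_m modnDmr; apply/eqP.
by congr modn; lia.
Qed.
End Objects.
End Cyclic.

(* Main.v *)
(* For x in C, let rep x be the representable module Z[Hom(x, -)].  Summed over
   all objects, every rep x becomes the ring
     Z[C] (x) Z[C] = Z[L, R] / (p(L), p(R)),  where p(t) = t^(m+q) - t^m
   and L, R are the operators 1_* and 1^*.  There S is the multiplication by
   L - R and T the multiplication by (p(L) - p(R)) / (L - R).  As in the
   two-periodic resolution of Z[t]/(p) as a bimodule over itself,
     ... -> rep(m+1) -S-> rep(m) -T-> rep(1) -S-> rep(0) -> Z
   is a projective resolution; it is contracted by maps that are linear in L
   only.  By the Yoneda lemma, applying Hom(-, A) gives the complex of the maps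
   S and T between the groups A(rm) and A(rm + 1). *)

From HB Require Import structures.
Require Import Defs.
From mathcomp Require Import all_boot all_order all_algebra.
From mathcomp Require Import boolp.
From mathcomp Require Import freeg zify.

Set Implicit Arguments.
Unset Strict Implicit.
Unset Printing Implicit Defensive.

(** * Subquotients *)

Section SubquotientIsom.
Import GRing.Theory.
Local Open Scope ring_scope.
Local Open Scope quotient_scope.

Definition subg_map (U V : zmodType) (K : zmodClosed U) (L : zmodClosed V)
    (f : {additive U -> V}) (fK : forall x, x \in K -> f x \in L) (x : subg K) :
  subg L := exist _ (f (\val x)) (fK _ (valP x)).

Lemma subg_map_zmod_morphism (U V : zmodType) (K : zmodClosed U)
    (L : zmodClosed V) (f : {additive U -> V})
    (fK : forall x, x \in K -> f x \in L) :
  zmod_morphism (subg_map fK).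
Proof. by move=> x y; apply: val_inj; rewrite /= !raddfB. Qed.

HB.instance Definition _ U V K L f fK :=
  GRing.isZmodMorphism.Build (@subg U K) (@subg V L) (@subg_map U V K L f fK)
    (@subg_map_zmod_morphism U V K L f fK).

Lemma zmod_isom_trans (U V W : zmodType) :
  zmod_isom U V -> zmod_isom V W -> zmod_isom U W.
Proof. by case=> f bf [g bg]; exists (g \o f); apply: bij_comp. Qed.

Section Projection.
Variables (V : zmodType) (K I : zmodClosed V).

Definition sqpi : {additive subg K -> subquot K I} :=
  \pi_({ideal_quot (@Defs.relp V K I)}).

Lemma sqpi_surj (y : subquot K I) : exists x, sqpi x = y.
Proof. by exists (repr y); rewrite /sqpi /= reprK. Qed.

Lemma sqpi_eq (x y : subg K) : sqpi x = sqpi y <-> \val x - \val y \in I.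
Proof.
have -> : (\val x - \val y \in I) = (x - y \in @Defs.relp V K I).
  by rewrite [RHS]inE raddfB.
by rewrite Quotient.idealrBE; split=> [/eqP|/eqP].
Qed.
End Projection.

(** [f] and [g] are inverse only modulo [I] and [J], which is what homotopy equivalences provide;
    Yoneda bijections are the strict case. *)
Lemma subquot_isom (U V : zmodType) (K I : zmodClosed U) (L J : zmodClosed V)
    (f : {additive U -> V}) (g : {additive V -> U}) :
    (forall x, x \in K -> f x \in L) -> (forall x, x \in I -> f x \in J) ->
    (forall y, y \in L -> g y \in K) -> (forall y, y \in J -> g y \in I) ->
    (forall x, x \in K -> g (f x) - x \in I) ->
    (forall y, y \in L -> f (g y) - y \in J) ->
  zmod_isom (subquot K I) (subquot L J).
Proof.
move=> fK fI gL gJ gf fg.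
(* [F] and [G] act on chosen representatives; [Fpi] and [Gpi] show that the choice does not matter,
   since [f] and [g] respect [I] and [J]. *)
pose F (u : subquot K I) : subquot L J := sqpi L J (subg_map fK (repr u)).
pose G (v : subquot L J) : subquot K I := sqpi K I (subg_map gL (repr v)).
have Fpi x : F (sqpi K I x) = sqpi L J (subg_map fK x).
  apply/sqpi_eq; rewrite /= -raddfB; apply/fI/sqpi_eq.
  by rewrite /sqpi /= reprK.
have Gpi y : G (sqpi L J y) = sqpi K I (subg_map gL y).
  apply/sqpi_eq; rewrite /= -raddfB; apply/gJ/sqpi_eq.
  by rewrite /sqpi /= reprK.
have F_zmod : zmod_morphism F.
  move=> u v; have [x <-] := sqpi_surj u; have [y <-] := sqpi_surj v.
  by rewrite -raddfB !Fpi -raddfB; congr (sqpi L J _); rewrite raddfB.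
pose FF := GRing.isZmodMorphism.Build _ _ F F_zmod.
pose Fa : {additive subquot K I -> subquot L J} := HB.pack F FF.
exists Fa; exists G => [u|v] /=.
  have [x <-] := sqpi_surj u; rewrite Fpi Gpi; apply/sqpi_eq.
  by apply: gf; apply: valP.
have [x <-] := sqpi_surj v; rewrite Gpi Fpi; apply/sqpi_eq.
by apply: fg; apply: valP.
Qed.

(** For degree 0, where the coboundaries vanish and the answer is a subgroup. *)
Lemma subquot0_isom (U : zmodType) (K I : zmodClosed U) :
  (forall x, x \in I -> x = 0) -> zmod_isom (subg K) (subquot K I).
Proof.
move=> I0; exists (sqpi K I); exists repr => [x|y];
  last by rewrite /sqpi /= reprK.
apply/val_inj/eqP; rewrite -subr_eq0; apply/eqP/I0/sqpi_eq.
by rewrite /sqpi /= reprK.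
Qed.

Lemma zmod_isom_sym (U V : zmodType) : zmod_isom U V -> zmod_isom V U.
Proof.
case=> f [g fK gK].
pose G := GRing.isZmodMorphism.Build _ _ g (can2_zmod_morphism fK gK).
pose Ga : {additive V -> U} := HB.pack g G.
by exists Ga; exists f.
Qed.
End SubquotientIsom.

(** * Comparison of projective resolutions *)

Section Comparison.
Import GRing.Theory.
Local Open Scope ring_scope.
Variable M : nmodType.
Implicit Types A B C D E : dmodule M.

Lemma dmor_compA A B C D (h : dmor C D) (g : dmor B C) (f : dmor A B) :
  dmor_comp h (dmor_comp g f) = dmor_comp (dmor_comp h g) f.
Proof. exact: dmor_inj. Qed.

Lemma dmor_compDl A B C (g h : dmor B C) (f : dmor A B) :
  dmor_comp (g + h) f = dmor_comp g f + dmor_comp h f.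
Proof. exact: dmor_inj. Qed.

Lemma dmor_compBl A B C (g h : dmor B C) (f : dmor A B) :
  dmor_comp (g - h) f = dmor_comp g f - dmor_comp h f.
Proof. exact: dmor_inj. Qed.

Lemma dmor_compDr A B C (h : dmor B C) (f g : dmor A B) :
  dmor_comp h (f + g) = dmor_comp h f + dmor_comp h g.
Proof. by apply: dmor_inj => x a /=; rewrite raddfD. Qed.

Lemma dmor_compBr A B C (h : dmor B C) (f g : dmor A B) :
  dmor_comp h (f - g) = dmor_comp h f - dmor_comp h g.
Proof. by apply: dmor_inj => x a; apply: (raddfB (h x)). Qed.

Lemma dmor_comp0l A B C (f : dmor A B) : dmor_comp (0 : dmor B C) f = 0.
Proof. exact: dmor_inj. Qed.

Lemma dmor_comp0r A B C (f : dmor B C) : dmor_comp f (0 : dmor A B) = 0.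
Proof. by apply: dmor_inj => x a /=; rewrite raddf0. Qed.

Definition dmor_id A : dmor A A.
Proof. by exists (fun x => idfun : {additive A x -> A x}). Defined.

Lemma dmor_comp1l A B (f : dmor A B) : dmor_comp (dmor_id B) f = f.
Proof. exact: dmor_inj. Qed.

Lemma dmor_comp1r A B (f : dmor A B) : dmor_comp f (dmor_id A) = f.
Proof. exact: dmor_inj. Qed.

Lemma dexact_comp0 A B C (f : dmor A B) (g : dmor B C) :
  dexact f g -> dmor_comp g f = 0.
Proof. by move=> fg; apply: dmor_inj => x a /=; apply/fg; exists a. Qed.

(** By exactness [f] maps onto the kernel of [g], and [h] lands in that kernel; projectivity is
    applied to the two corestrictions. *)
Lemma projective_lift A B C D (f : dmor A B) (g : dmor B C) (h : dmor D B) :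
    projective D -> dexact f g -> dmor_comp g h = 0 ->
  exists k : dmor D A, dmor_comp f k = h.
Proof.
move=> projD fg gh0.
have corestr E (k : dmor E B) : dmor_comp g k = 0 ->
    exists k' : dmor E (ker_mod g), dmor_comp (ker_incl g) k' = k.
  move=> gk0.
  have kP x a : k x a \in kerp (g x).
    by rewrite inE -[g x _]/(dmor_comp g k x a) gk0.
  pose k1 x a : ker_mod g x := exist _ (k x a) (kP x a).
  have k1_zmod x : zmod_morphism (k1 x).
    by move=> a b; apply: val_inj; rewrite /= raddfB.
  pose k2 x := GRing.isZmodMorphism.Build _ _ (k1 x) (k1_zmod x).
  pose k3 x : {additive E x -> ker_mod g x} := HB.pack (k1 x) (k2 x).
  have k3_nat y z (u : darr y z) (a : E y) :
      k3 z (dact E u a) = dact (ker_mod g) u (k3 y a).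
    by apply: val_inj; rewrite /= dmor_nat.
  by exists (DMor k3_nat); apply: dmor_inj.
have [f' f'E] := corestr _ f (dexact_comp0 fg).
have [h' h'E] := corestr _ h gh0.
have f'_surj : dsurj f'.
  move=> x [b kb]; have /fg[a ab] : g x b = 0 by apply/eqP.
  by exists a; apply: val_inj; rewrite /= -ab -f'E.
have [k kE] := projD _ _ f' h' f'_surj.
by exists k; rewrite -f'E -dmor_compA kE.
Qed.

(** * Chain maps and homotopies between resolutions *)

Section Augmented.
Variables (B : dmodule M) (P : proj_resolution B).

(** Treating the augmentation as the differential out of degree 0 lets one lifting argument cover
    all degrees. *)
Definition aug_tgt (n : nat) : dmodule M := if n is k.+1 then P k else B.

Definition aug_d (n : nat) : dmor (P n) (aug_tgt n) :=
  match n with 0 => res_aug P | k.+1 => res_d P k end.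

Definition bd_in (n : nat) : dmor (P n) (P n.-1) :=
  match n with 0 => 0 | k.+1 => res_d P k end.

Lemma bd_in_res_d n : dmor_comp (bd_in n) (res_d P n) = 0.
Proof.
case: n => [|n] /=; first by rewrite dmor_comp0l.
by apply: dexact_comp0; apply: res_exactS.
Qed.

Lemma cobd_inE A n (k : dmor (P n.-1) A) :
  cobd_in P A n k = dmor_comp k (bd_in n).
Proof. by case: n k => [|n] k //=; rewrite dmor_comp0r. Qed.

Lemma aug_exact n : dexact (res_d P n) (aug_d n).
Proof. by case: n => [|n]; [apply: res_exact0 | apply: res_exactS]. Qed.
End Augmented.

Section TwoResolutions.
Variables (B : dmodule M) (P Q : proj_resolution B).

Definition chain_map (f : forall n, dmor (P n) (Q n)) : Prop :=
  forall n, dmor_comp (res_d Q n) (f n.+1) = dmor_comp (f n) (res_d P n).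

Lemma chain_map_exists : exists2 f,
  chain_map f & dmor_comp (res_aug Q) (f 0) = res_aug P.
Proof.
(* [good n f] is the condition under which [f] after [res_d P n] lifts through [res_d Q n]; the
   recursion carries it along with the map. *)
pose good n (f : dmor (P n) (Q n)) :=
  dmor_comp (dmor_comp (aug_d Q n) f) (res_d P n) = 0.
have [f0 f0E] := res_proj (res_aug P) (@res_surj _ _ Q).
have good0 : good 0 f0.
  by rewrite /good /= f0E; apply: dexact_comp0; apply: res_exact0.
have next n (f : {f | good n f}) : {g : dmor (P n.+1) (Q n.+1) |
    dmor_comp (res_d Q n) g = dmor_comp (sval f) (res_d P n)}.
  apply: cid; apply: projective_lift; first exact: res_proj.
    exact: aug_exact.
  by rewrite dmor_compA; exact: (svalP f).
have nextP n f : good n.+1 (sval (next n f)).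
  rewrite /good /= (svalP (next n f)) -dmor_compA.
  by rewrite (dexact_comp0 (@res_exactS _ _ P n)) dmor_comp0r.
pose F := nat_rect (fun n => {f | good n f}) (exist _ f0 good0)
  (fun n f => exist _ (sval (next n f)) (nextP n f)).
by exists (fun n => sval (F n)) => // n; rewrite (svalP (next n (F n))).
Qed.

(** Induction on the degree: the [s] built in degree [n] serves as [t] in degree [n.+1]. *)
Lemma chain_map_null_homotopic f :
    chain_map f -> dmor_comp (res_aug Q) (f 0) = 0 ->
  forall n, exists (t : dmor (P n.-1) (Q n)) (s : dmor (P n) (Q n.+1)),
    f n = dmor_comp (res_d Q n) s + dmor_comp t (bd_in P n).
Proof.
move=> cf f0; elim=> [|n [t [s fE]]].
  have [s sE] := projective_lift (@res_proj _ _ P 0) (@res_exact0 _ _ Q) f0.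
  by exists 0, s; rewrite dmor_comp0r addr0.
(* What the old homotopy leaves of [f n.+1] is a cycle, because the term through [bd_in P n] dies
   after composition with [res_d P n]. *)
have [|u uE] := @projective_lift _ _ _ _ (res_d Q n.+1) (res_d Q n)
  (f n.+1 - dmor_comp s (res_d P n)) (@res_proj _ _ P n.+1)
  (@res_exactS _ _ Q n).
  rewrite dmor_compBr cf fE dmor_compDl -!dmor_compA.
  by rewrite bd_in_res_d dmor_comp0r addr0 subrr.
by exists s, u; rewrite uE subrK.
Qed.
End TwoResolutions.

Lemma precomp_cocycle B (P Q : proj_resolution B) f (cf : @chain_map B P Q f)
    A n (h : dmor (Q n) A) :
  h \in kerp (cobd Q A n) -> precomp (f n) h \in kerp (cobd P A n).
Proof.
rewrite !inE => /eqP h0; apply/eqP.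
change (dmor_comp (dmor_comp h (f n)) (res_d P n) = 0).
rewrite -dmor_compA -cf.
by rewrite dmor_compA [dmor_comp h _]h0 dmor_comp0l.
Qed.

Lemma precomp_coboundary B (P Q : proj_resolution B) f
    (cf : @chain_map B P Q f) A n (h : dmor (Q n) A) :
  h \in imp (cobd_in Q A n) -> precomp (f n) h \in imp (cobd_in P A n).
Proof.
case/asboolP=> k <-; apply/asboolP; exists (dmor_comp k (f n.-1)).
rewrite !cobd_inE.
change (dmor_comp (dmor_comp k (f n.-1)) (bd_in P n)
        = dmor_comp (dmor_comp k (bd_in Q n)) (f n)).
rewrite -!dmor_compA; congr (dmor_comp k _).
by case: n {h k} => [|n] /=; rewrite ?dmor_comp0l ?dmor_comp0r ?cf.
Qed.

Lemma chain_map_homotopic_id B (P : proj_resolution B)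
    (f : forall n, dmor (P n) (P n)) :
    chain_map f -> dmor_comp (res_aug P) (f 0) = res_aug P ->
  forall n, exists (t : dmor (P n.-1) (P n)) (s : dmor (P n) (P n.+1)),
    f n - dmor_id (P n) = dmor_comp (res_d P n) s + dmor_comp t (bd_in P n).
Proof.
move=> cf f0.
apply: (@chain_map_null_homotopic B P P (fun n => f n - dmor_id _)).
  by move=> n; rewrite dmor_compBr dmor_compBl cf dmor_comp1l dmor_comp1r.
by rewrite dmor_compBr f0 dmor_comp1r subrr.
Qed.

(** A cocycle [h] kills the homotopy term through [res_d P n]; what remains is the coboundary of
    [dmor_comp h t]. *)
Lemma precomp_homotopic_id B (P : proj_resolution B)
    (f : forall n, dmor (P n) (P n)) :
    chain_map f -> dmor_comp (res_aug P) (f 0) = res_aug P ->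
  forall A n (h : dmor (P n) A), h \in kerp (cobd P A n) ->
  dmor_comp h (f n) - h \in imp (cobd_in P A n).
Proof.
move=> cf f0 A n h; rewrite inE => /eqP h0; apply/asboolP.
have [t [s E]] := chain_map_homotopic_id cf f0 n.
exists (dmor_comp h t).
rewrite cobd_inE -[X in _ - X]dmor_comp1r -dmor_compBr E dmor_compDr.
by rewrite !dmor_compA [dmor_comp h (res_d P n)]h0 dmor_comp0l add0r.
Qed.

(** Comparison maps in the two directions compose to chain maps over the identity of [B], hence
    homotopic to the identity. *)
Lemma Ext_resolution_independent B (P Q : proj_resolution B) A n :
  zmod_isom (Ext P A n) (Ext Q A n).
Proof.
have [f cf f0] := chain_map_exists P Q; have [g cg g0] := chain_map_exists Q P.
have comp_chain (P1 P2 : proj_resolution B) (f1 : forall n, dmor (P1 n) (P2 n))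
    (f2 : forall n, dmor (P2 n) (P1 n)) :
    chain_map f1 -> chain_map f2 ->
    chain_map (fun n => dmor_comp (f2 n) (f1 n)).
  by move=> c1 c2 k; rewrite dmor_compA c2 -dmor_compA c1 dmor_compA.
apply: (@subquot_isom _ _ _ _ _ _ (precomp (g n)) (precomp (f n))).
- exact: precomp_cocycle.
- exact: precomp_coboundary.
- exact: precomp_cocycle.
- exact: precomp_coboundary.
- move=> h hP.
  change (dmor_comp (dmor_comp h (g n)) (f n) - h \in imp (cobd_in P A n)).
  rewrite -dmor_compA.
  apply: (precomp_homotopic_id (comp_chain _ _ _ _ cf cg)) => //.
  by rewrite dmor_compA g0 f0.
- move=> h hP.
  change (dmor_comp (dmor_comp h (f n)) (g n) - h \in imp (cobd_in Q A n)).
  rewrite -dmor_compA.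
  apply: (precomp_homotopic_id (comp_chain _ _ _ _ cg cf)) => //.
  by rewrite dmor_compA f0 g0.
Qed.
End Comparison.

(** * Representable modules *)

Section Representable.
Import GRing.Theory.
Local Open Scope ring_scope.
Variables (M : nmodType) (x : M).

Definition rep_obj (y : M) : zmodType := {freeg (darr x y) / int}.

Definition rep_act (y z : M) (g : darr y z) :
    {additive rep_obj y -> rep_obj z} :=
  flift (fun f => << darr_comp g f >> : rep_obj z).

Definition rep : dmodule M.
Proof.
exists rep_obj rep_act.
- move=> y a; apply: (free_ext (g := rep_act _) (h := idfun)) => f.
  by rewrite /= fliftU darr_id_comp.
- move=> w y z g f a.
  apply: (free_ext (g := rep_act _) (h := rep_act g \o rep_act f)) => h.
  by rewrite /= !fliftU darr_compA.
Defined.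

Definition rep_gen : rep x := << darr_id x >> : rep_obj x.

Lemma rep_basis (y : M) (f : darr x y) : dact rep f rep_gen = << f >>.
Proof. by rewrite /= fliftU darr_comp_id. Qed.

(** Each basis arrow is its own image of the identity, so naturality determines a morphism from its
    value on [rep_gen]. *)
Lemma rep_hom_ext (A : dmodule M) (g h : dmor rep A) :
  g x rep_gen = h x rep_gen -> g = h.
Proof.
move=> gh; apply: dmor_inj => y; apply: free_ext => f.
by rewrite -rep_basis !dmor_nat gh.
Qed.

Section Yoneda.
Variables (A : dmodule M) (a : A x).

Definition yoneda_fun (y : M) : {additive rep_obj y -> A y} :=
  flift (fun f : darr x y => dact A f a).

Definition yoneda : dmor rep A.
Proof.
exists yoneda_fun => y z g b.
apply: (free_ext (g := yoneda_fun z \o rep_act g)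
  (h := dact A g \o yoneda_fun y)).
by move=> f; rewrite /= !fliftU dact_comp.
Defined.

Lemma yoneda_gen : yoneda x rep_gen = a.
Proof. by rewrite /= fliftU dact_id. Qed.
End Yoneda.

Lemma yonedaK (A : dmodule M) (g : dmor rep A) : yoneda (g x rep_gen) = g.
Proof. by apply: rep_hom_ext; rewrite yoneda_gen. Qed.

Lemma yoneda_zmod_morphism (A : dmodule M) : zmod_morphism (@yoneda A).
Proof. by move=> a b; apply: rep_hom_ext; rewrite /= !fliftU !dact_id. Qed.

HB.instance Definition _ (A : dmodule M) :=
  GRing.isZmodMorphism.Build (A x) (dmor rep A)
  (@yoneda A) (@yoneda_zmod_morphism A).

Definition eval_gen (A : dmodule M) (g : dmor rep A) : A x := g x rep_gen.

Lemma eval_gen_zmod_morphism (A : dmodule M) : zmod_morphism (@eval_gen A).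
Proof. by []. Qed.

HB.instance Definition _ (A : dmodule M) :=
  GRing.isZmodMorphism.Build (dmor rep A) (A x)
  (@eval_gen A) (@eval_gen_zmod_morphism A).

Lemma rep_projective : projective rep.
Proof.
move=> B C e f /(_ x (f x rep_gen))[b eb]; exists (yoneda b).
by apply: rep_hom_ext; rewrite -[LHS]/(e x _) yoneda_gen.
Qed.
End Representable.

(** * The periodic resolution *)

(** Exactness is tested object by object, so [s] and [t] are mere families of functions: the
    contraction below commutes with L but not with R, hence is no morphism of modules. *)
Lemma dexact_contraction (M : nmodType) (A B C : dmodule M) (f : dmor A B)
    (g : dmor B C) (s : forall y, B y -> A y) (t : forall y, C y -> B y) :
    dmor_comp g f = 0%R -> (forall y, t y 0%R = 0%R) ->
    (forall y b, b = f y (s y b) + t y (g y b))%R ->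
  dexact f g.
Proof.
move=> gf0 t0 st y b; split=> [gb0|[a <-]].
  by exists (s y b); rewrite [RHS]st gb0 t0 GRing.addr0.
by rewrite -[LHS]/(dmor_comp g f y a) gf0.
Qed.

Section CyclicResolution.
Import GRing.Theory.
Local Open Scope ring_scope.
Variables (m q : nat) (q_gt0 : (0 < q)%N).
Local Notation C := (cyc m q_gt0).
Local Notation wp := (wp m q_gt0).
Local Notation N := (m + q)%N.
Implicit Types (x y z : C) (A B : dmodule C).

(** * Calculus of the partial action [pact] *)

Lemma wp_wpn k : wp (wpn m q k) = wp k.
Proof. exact: (wp_val (wp k)). Qed.

Lemma pactP A x z k l (a : A x) :
  (exists2 f : darr x z, \val f = (wp k, wp l) & pact z k l a = dact A f a)
  \/ (wp k + x + wp l != z /\ pact z k l a = 0).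
Proof.
rewrite /pact; case: insubP => [f _ ef|]; first by left; exists f.
by right.
Qed.

Lemma pact_zmod_morphism A x z k l : zmod_morphism (@pact m q q_gt0 A x z k l).
Proof.
by move=> a b; rewrite /pact; case: insub => [f|]; rewrite ?raddfB ?subr0.
Qed.

HB.instance Definition _ (A : dmodule C) x z k l :=
  GRing.isZmodMorphism.Build (A x) (A z)
  (@pact m q q_gt0 A x z k l) (@pact_zmod_morphism A x z k l).

Lemma pactB A x z k l (a b : A x) :
  pact z k l (a - b) = pact z k l a - pact z k l b.
Proof. exact: pact_zmod_morphism. Qed.

Lemma pact_sum A x z k l n (F : 'I_n -> A x) :
  pact z k l (\sum_(i < n) F i) = \sum_(i < n) pact z k l (F i).
Proof. exact: (raddf_sum (@pact m q q_gt0 A x z k l)). Qed.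

Lemma dmor_pact A B (g : dmor A B) x z k l (a : A x) :
  g z (pact z k l a) = pact z k l (g x a).
Proof. by rewrite /pact; case: insub => [f|]; rewrite ?dmor_nat ?raddf0. Qed.

Lemma pact_out A x z k l (a : A x) : wp k + x + wp l != z -> pact z k l a = 0.
Proof.
case: (pactP z k l a) => [[f ef _]|[] //].
by have := valP f; rewrite /= ef /= => ->.
Qed.

Lemma eq_pact A x z k k' l l' (a : A x) :
  wp k = wp k' -> wp l = wp l' -> pact z k l a = pact z k' l' a.
Proof. by rewrite /pact => -> ->. Qed.

(** Once the inner triple is an arrow, the outer one is an arrow exactly when the composite is;
    otherwise both sides are 0. *)
Lemma pact_comp A x y z i j k l (a : A x) : wp i + x + wp j = y ->
  pact z k l (pact y i j a) = pact z (k + i) (j + l) a.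
Proof.
move=> ey; case: (pactP y i j a) => [[f ef ->]|[]]; last by rewrite ey eqxx.
case: (pactP z k l (dact A f a)) => [[g eg ->]|[nz ->]].
  by rewrite -dact_comp; apply: pactE; rewrite /= eg ef /= !wpD.
rewrite pact_out //; move: nz; rewrite -ey -!wpD.
by rewrite !addrA.
Qed.

Lemma pact_gen x y (f : darr x y) :
  << f >> = pact y (\val f).1 (\val f).2 (rep_gen x) :> rep x y.
Proof.
by rewrite -rep_basis; apply: pactE; rewrite !wp_val -surjective_pairing.
Qed.

(** The R-exponent [l] is kept below [N], the range where the homotopy formulas hold; they are
    linear in L, so [k] is left free. *)
Lemma rep_obj_ext x y (V : zmodType) (g h : {additive rep x y -> V}) :
    (forall k l, (l < N)%N -> wp k + x + wp l = y ->
      g (pact y k l (rep_gen x)) = h (pact y k l (rep_gen x))) ->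
  g =1 h.
Proof.
move=> gh; apply: (free_ext (g := g) (h := h)) => f.
rewrite pact_gen; apply: gh; first exact: ltn_ord.
by rewrite !wp_val; apply/eqP; apply: (valP f).
Qed.

Section Lift.
Variables (x y : C) (V : zmodType) (G : nat -> nat -> V).

Definition rep_lift : {additive rep x y -> V} :=
  flift (fun f : darr x y => G (\val f).1 (\val f).2).

Lemma rep_lift_pact k l : rep_lift (pact y k l (rep_gen x)) =
  if wp k + x + wp l == y then G (wp k) (wp l) else 0.
Proof.
case: ifPn => [e|/pact_out ->]; last by rewrite raddf0.
have -> : pact y k l (rep_gen x) = << exist _ (wp k, wp l) e : darr x y >>.
  by rewrite pact_gen; apply: eq_pact; rewrite wp_wpn.
by rewrite /rep_lift /= fliftU.
Qed.
End Lift.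

(** * S and T between arbitrary objects *)

Definition diffS A x z (a : A x) : A z := pact z 1 0 a - pact z 0 1 a.

Definition diffT A x z (a : A x) : A z :=
  \sum_(t < N) pact z (N - t - 1) t a - \sum_(s < m) pact z (m - s - 1) s a.

(* The target [z] is free, so that the equations between objects, such as
   [y = wp m + w], need no transport; the value is junk when [z] is not the
   object that the formula prescribes. *)
Definition diff (b : bool) A x z (a : A x) : A z :=
  if b then diffT z a else diffS z a.

Lemma diff_zmod_morphism b A x z : zmod_morphism (@diff b A x z).
Proof.
move=> a c; rewrite /diff; case: b; rewrite /diffT /diffS.
  under eq_bigr do rewrite raddfB.
  under [X in _ - X]eq_bigr do rewrite raddfB.
  by rewrite !sumrB !opprD addrACA.
by rewrite !raddfB addrACA.
Qed.

HB.instance Definition _ b (A : dmodule C) x z :=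
  GRing.isZmodMorphism.Build (A x) (A z)
  (@diff b A x z) (@diff_zmod_morphism b A x z).

Lemma dmor_diff A B (g : dmor A B) b x z (a : A x) :
  g z (diff b z a) = diff b z (g x a).
Proof.
case: b; rewrite /diff /diffT /diffS (raddfB (g z)) ?dmor_pact //.
rewrite !(raddf_sum (g z)).
by congr (_ - _); apply: eq_bigr => t _; rewrite dmor_pact.
Qed.

Lemma Smap_diff A x (a : A x) : Smap a = diff false (x + wp 1) a.
Proof.
rewrite /Smap /diff /diffS; congr (_ - _); exact: pactE.
Qed.

Lemma Tmap_diff A x y (x_gt0 : (0 < x)%N) (y_def : y = wp m + wp x.-1)
    (a : A x) :
  Tmap x_gt0 y_def a = diff true y a.
Proof.
rewrite /Tmap /diff /diffT; congr (_ - _); apply: eq_bigr => t _;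
  by rewrite -dact_comp; apply: pactE; rewrite /= add0r add0r.
Qed.

Lemma in_invS A x (a : A x) : (a \in invS A x) <-> diff false (x + wp 1) a = 0.
Proof. by rewrite -Smap_diff inE; split=> /eqP. Qed.

Lemma in_imS A x (b : A (x + wp 1)) :
  (b \in imS A x) <-> exists a : A x, diff false (x + wp 1) a = b.
Proof.
split=> [/asboolP[a <-]|[a <-]]; first by exists a; rewrite -Smap_diff.
by apply/asboolP; exists a; apply: Smap_diff.
Qed.

Lemma in_invT A x (x_gt0 : (0 < x)%N) (a : A x) :
  (a \in invT A x_gt0) <-> diff true (wp m + wp x.-1) a = 0.
Proof. by rewrite -(Tmap_diff x_gt0 erefl) inE; split=> /eqP. Qed.

Lemma in_imT A x y (x_gt0 : (0 < x)%N) (y_def : y = wp m + wp x.-1) (b : A y) :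
  (b \in imT A x_gt0 y_def) <-> exists a : A x, diff true y a = b.
Proof.
split=> [/asboolP[a <-]|[a <-]].
  by exists a; rewrite -(Tmap_diff x_gt0 y_def).
by apply/asboolP; exists a; apply: Tmap_diff.
Qed.

(** The two sums telescope to L^N - R^N and L^m - R^m, which agree because [wp N] is [wp m]. *)
Lemma diffTS A x y z (a : A x) : y = x + wp 1 -> diffT z (diffS y a) = 0.
Proof.
move=> ey; have e1 : wp 1 + x + wp 0 = y by rewrite addr0 addrC.
have e2 : wp 0 + x + wp 1 = y by rewrite [wp 0 + x]add0r.
rewrite -[RHS](pact_cancel z a) /diffT /diffS.
congr (_ - _); apply: eq_bigr => t _; rewrite pactB !pact_comp //;
  congr (_ - _); apply: eq_pact; congr wp; have := ltn_ord t; lia.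
Qed.

Lemma wp_loop k l : (m <= k)%N -> (k + q = l)%N -> wp k = wp l.
Proof. by move=> mk <-; rewrite addnC wp_period. Qed.

Lemma diffST A w x y z (a : A x) : x = w + wp 1 -> y = wp m + w ->
  diffS z (diffT y a) = 0.
Proof.
move=> ex ey.
(* [pact_comp] requires every summand of T to end at [y]; in the first sum this takes one turn
   around the period. *)
have e1 (t : 'I_N) : wp (N - t - 1) + x + wp t = y.
  rewrite ex ey -(wp_val w) !wpD; apply/esym/wp_loop; first lia.
  by have := ltn_ord t; lia.
have e2 (s : 'I_m) : wp (m - s - 1) + x + wp s = y.
  rewrite ex ey -(wp_val w) !wpD; congr wp.
  by have := ltn_ord s; lia.
rewrite -[RHS](pact_cancel z a) /diffT /diffS !pactB.
rewrite !pact_sum opprD addrACA -opprD -!sumrB.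
congr (_ - _); apply: eq_bigr => t _; rewrite !pact_comp ?e1 ?e2 //;
  congr (_ - _); apply: eq_pact; congr wp; have := ltn_ord t; lia.
Qed.

(** * Differentials between representable modules *)

Definition rdiff b x z : dmor (rep z) (rep x) := yoneda (diff b z (rep_gen x)).

Lemma rdiff_gen b x z :
  rdiff b x z z (rep_gen z) = diff b z (rep_gen x).
Proof. exact: yoneda_gen. Qed.

(** Under the Yoneda bijection the coboundary of Hom(rep, [A]) becomes S or T on [A]. *)
Lemma dmor_rdiff A b x z (g : dmor (rep x) A) :
  eval_gen (dmor_comp g (rdiff b x z)) = diff b z (eval_gen g).
Proof. by rewrite -dmor_diff -rdiff_gen. Qed.

(** Yoneda reverses the order of composition: on the generator this is T after S, and [rdiffTS] is S
    after T. *)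
Lemma rdiffST x0 x1 x2 : x1 = x0 + wp 1 ->
  dmor_comp (rdiff false x0 x1) (rdiff true x1 x2) = 0.
Proof.
move=> x1E; apply: rep_hom_ext.
by rewrite -/(eval_gen _) dmor_rdiff /eval_gen rdiff_gen [LHS]diffTS.
Qed.

Lemma rdiffTS x0 x1 x2 x3 : x1 = x0 + wp 1 -> x2 = wp m + x0 ->
  dmor_comp (rdiff true x1 x2) (rdiff false x2 x3) = 0.
Proof.
move=> x1E x2E; apply: rep_hom_ext.
rewrite -/(eval_gen _) dmor_rdiff /eval_gen rdiff_gen.
exact: (diffST _ _ x1E x2E).
Qed.

(* In the ring of the header, [e x k l] is L^k R^l and the contraction is
   [htpS : R^l |-> (R^l - L^l) / (L - R)] and
   [htpT : R^(m+q-1) |-> 1, R^l |-> 0 for l < m+q-1]. *)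
Section Homotopy.
Variables (x0 x1 x2 y : C) (x1_def : x1 = x0 + wp 1) (x2_def : x2 = wp m + x0).
Local Notation e x k l := (pact y k l (rep_gen x)).

Definition htpS : {additive rep x0 y -> rep x1 y} :=
  rep_lift _ _ (fun k l => - \sum_(i < l) e x1 (k + (l - 1 - i)) i).

Definition htpT : {additive rep x1 y -> rep x2 y} :=
  rep_lift _ _ (fun k l => if (l == N.-1)%N then e x2 k 0 else 0).

Lemma htpS_pact k l : (l < N)%N ->
  htpS (e x0 k l) = - \sum_(i < l) e x1 (k + (l - 1 - i)) i.
Proof.
move=> lN; rewrite rep_lift_pact /= (wpn_small lN); case: eqP => [_|/eqP ne].
  congr (- _); apply: eq_bigr => i _.
  by apply: (@eq_pact (rep _)); rewrite // -!wpD wp_wpn.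
(* If (k, l) gives no arrow from [x0] to [y], no summand gives one from [x1]: the exponents drop by
   1 in total and [x1] exceeds [x0] by 1. *)
rewrite big1 ?oppr0 // => i _; apply: (@pact_out (rep _)).
apply: contraNneq ne => <-; rewrite x1_def -(wp_val x0) !wpD.
apply/eqP; congr wp.
by have := ltn_ord i; lia.
Qed.

Lemma htpT_pact k l : (l < N)%N ->
  htpT (e x1 k l) = if (l == N.-1)%N then e x2 k 0 else 0.
Proof.
move=> lN; rewrite rep_lift_pact /= (wpn_small lN).
case: ifP => [_|/negbT ne]; case: eqP => // lE.
  by apply: (@eq_pact (rep _)); rewrite // wp_wpn.
(* For l = N - 1 the triples on both sides have the same sum, since x1 + (N - 1) = x0 + N = x0 + m =
   x2 in the monoid. *)
apply/esym/(@pact_out (rep _)); apply: contraNneq ne => <-.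
rewrite lE x1_def x2_def -(wp_val x0) !wpD; apply/eqP/esym/wp_loop; lia.
Qed.

Local Notation resS := (rdiff false x0 x1).
Local Notation resT := (rdiff true x1 x2).

Lemma resS_pact k l : resS y (e x1 k l) = e x0 k.+1 l - e x0 k l.+1.
Proof.
have e1 : wp 1 + x0 + wp 0 = x1 by rewrite addr0 addrC x1_def.
have e2 : wp 0 + x0 + wp 1 = x1 by rewrite [wp 0 + x0]add0r x1_def.
rewrite dmor_pact rdiff_gen /diff /diffS pactB.
by rewrite !pact_comp // addn1 addn0 add0n add1n.
Qed.

Lemma resT_pact k l : resT y (e x2 k l) =
  \sum_(t < N) e x1 (k + (N - t - 1)) (t + l) -
  \sum_(s < m) e x1 (k + (m - s - 1)) (s + l).
Proof.
rewrite dmor_pact rdiff_gen /diff /diffT pactB.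
rewrite !pact_sum.
congr (_ - _); apply: eq_bigr => t _; rewrite pact_comp //.
  rewrite x1_def x2_def -(wp_val x0) !wpD; apply/esym/wp_loop; first lia.
  by have := ltn_ord t; lia.
rewrite x1_def x2_def -(wp_val x0) !wpD; congr wp.
by have := ltn_ord t; lia.
Qed.

(** The product of L - R with (R^l - L^l) / (L - R), by telescoping: modulo the image of S every R
    may be replaced by L. *)
Lemma resS_htpS k l : (l < N)%N ->
  resS y (htpS (e x0 k l)) = e x0 k l - e x0 (k + l) 0.
Proof.
move=> lN; rewrite htpS_pact // (raddfN (resS y)) (raddf_sum (resS y)).
under eq_bigr do rewrite /= resS_pact.
(* The two terms are written as the values at i = l and i = 0 of L^(k + (l - i)) R^i. *)
rewrite -[X in e x0 X l - _](addn0 k) -[in X in X - _](subnn l).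
rewrite -[X in _ - e x0 (k + X) 0]subn0.
rewrite -(telescope_sumr (fun i => e x0 (k + (l - i)) i) (leq0n l)).
rewrite big_mkord -sumrN.
apply: eq_bigr => i _; rewrite opprB; congr (_ - _);
  apply: (@eq_pact (rep _)); congr wp; have := ltn_ord i; lia.
Qed.

(* T kills L - R, so that T R^l = T L^l and [l = 0] is enough. *)
Lemma htpT_resT k : htpT (resT y (e x2 k 0)) = e x2 k 0.
Proof.
have [n nE] : exists n, N = n.+1 by exists N.-1; lia.
(* In the second sum the R-exponents are below m, hence below N - 1, and [htpT] kills it; in the
   first only t = N - 1 survives and gives L^k. *)
rewrite resT_pact (raddfB htpT) !(raddf_sum htpT) [X in _ - X]big1 => [|s _].
  rewrite subr0 nE big_ord_recr big1 /= => [|t _].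
    rewrite add0r addn0 htpT_pact; last lia.
    by rewrite nE /= eqxx; apply: (@eq_pact (rep _)) => //; congr wp; lia.
  rewrite htpT_pact; last by have := ltn_ord t; lia.
  by case: eqP => // tE; have := ltn_ord t; lia.
rewrite htpT_pact; last by have := ltn_ord s; lia.
by case: eqP => // sE; have := ltn_ord s; lia.
Qed.

(** Let h_l be the sum of L^(l-1-i) R^i over i < l, so that h_(l+1) = L h_l + R^l. For l < N - 1,
    [htpS] after S sends R^l to h_(l+1) - L h_l = R^l. For l = N - 1 it gives h_m - L h_l, and T
    adds the missing h_N - h_m. *)
Lemma homotopyST b : b = resT y (htpT b) + htpS (resS y b).
Proof.
apply: (rep_obj_ext (g := idfun) (h := (resT y \o htpT) \+ (htpS \o resS y))).
move=> k l lN _ /=; rewrite htpT_pact // resS_pact (raddfB htpS).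
rewrite htpS_pact //; case: ifPn => [/eqP lE|/eqP lNE].
  (* [htpS_pact] needs an exponent below [N], so R^N is first reduced to R^m. *)
  have -> : e x0 k l.+1 = e x0 k m.
    by apply: (@eq_pact (rep _)) => //; apply/esym/wp_loop; lia.
  have NE : N = l.+1 by lia.
  rewrite resT_pact htpS_pact; last lia.
  rewrite NE big_ord_recr /=.
  have -> : \sum_(t < l) e x1 (k + (l.+1 - t - 1)) (t + 0)
      = \sum_(i < l) e x1 (k.+1 + (l - 1 - i)) i.
    apply: eq_bigr => i _; apply: (@eq_pact (rep _)); congr wp;
      have := ltn_ord i; lia.
  have -> : \sum_(s < m) e x1 (k + (m - s - 1)) (s + 0)
      = \sum_(i < m) e x1 (k + (m - 1 - i)) i.
    by apply: eq_bigr => i _; apply: (@eq_pact (rep _)); congr wp; lia.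
  rewrite opprK [- _ + _]addrC addrA subrK addrAC subrr add0r.
  by apply: (@eq_pact (rep _)); congr wp; lia.
rewrite (raddf0 (resT y)) htpS_pact; last lia.
rewrite big_ord_recr /=.
have -> : \sum_(i < l) e x1 (k + (l.+1 - 1 - i)) i
    = \sum_(i < l) e x1 (k.+1 + (l - 1 - i)) i.
  apply: eq_bigr => i _; apply: (@eq_pact (rep _)); congr wp;
    have := ltn_ord i; lia.
rewrite opprK add0r addKr.
by apply: (@eq_pact (rep _)); congr wp; lia.
Qed.
End Homotopy.

Lemma homotopyTS x0 x1 x2 x3 y (b : rep x2 y) :
    x1 = x0 + wp 1 -> x2 = wp m + x0 -> x3 = x2 + wp 1 ->
  b = rdiff false x2 x3 y (htpS x2 x3 y b)
      + htpT x1 x2 y (rdiff true x1 x2 y b).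
Proof.
move=> x1E x2E x3E.
apply: (rep_obj_ext (g := idfun) (h :=
  (rdiff false x2 x3 y \o htpS x2 x3 y)
  \+ (htpT x1 x2 y \o rdiff true x1 x2 y))).
move=> k l lN _ /=; rewrite resS_htpS //.
(* By [resS_htpS], R^l - L^l lies in the image of S, which T kills. *)
have -> : rdiff true x1 x2 y (pact y k l (rep_gen x2))
    = rdiff true x1 x2 y (pact y (k + l) 0 (rep_gen x2)).
  apply/eqP; rewrite -subr_eq0 -raddfB; apply/eqP.
  rewrite -(resS_htpS y x3E k lN).
  rewrite -[LHS]/(dmor_comp (rdiff true x1 x2) (rdiff false x2 x3) y _).
  by rewrite (rdiffTS _ x1E x2E).
by rewrite (htpT_resT _ x1E x2E) subrK.
Qed.

Lemma rdiff_exactST x0 x1 x2 : x1 = x0 + wp 1 -> x2 = wp m + x0 ->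
  dexact (rdiff true x1 x2) (rdiff false x0 x1).
Proof.
move=> x1E x2E; apply: (dexact_contraction (rdiffST _ x1E)
  (s := fun y => htpT x1 x2 y) (t := fun y => htpS x0 x1 y)) => y.
  exact: (raddf0 (htpS x0 x1 y)).
move=> b; exact: (homotopyST x1E x2E b).
Qed.

Lemma rdiff_exactTS x0 x1 x2 x3 :
    x1 = x0 + wp 1 -> x2 = wp m + x0 -> x3 = x2 + wp 1 ->
  dexact (rdiff false x2 x3) (rdiff true x1 x2).
Proof.
move=> x1E x2E x3E; apply: (dexact_contraction (rdiffTS _ x1E x2E)
  (s := fun y => htpS x2 x3 y) (t := fun y => htpT x1 x2 y)) => y.
  exact: (raddf0 (htpT x1 x2 y)).
move=> b; exact: (homotopyTS b x1E x2E x3E).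
Qed.

(** * The augmentation *)

Lemma const_int_pact x y k l (n : const_int C x) : wp k + x + wp l = y ->
  pact y k l n = n :> int.
Proof.
by move=> e; case: (pactP y k l n) => [[f _ ->]|[]] //; rewrite e eqxx.
Qed.

Definition aug : dmor (rep (0 : C)) (const_int C) :=
  @yoneda _ _ (const_int C) (1 : int).

Lemma aug_pact y k l : wp k + 0 + wp l = y ->
  aug y (pact y k l (rep_gen (0 : C))) = 1.
Proof.
by move=> ey; rewrite dmor_pact yoneda_gen [LHS]const_int_pact.
Qed.

(** A pure power of L is chosen because [htpS] contracts every basis element to one. *)
Definition aug_sect y : rep (0 : C) y := pact y y 0 (rep_gen (0 : C)).

Lemma aug_sectK y : aug y (aug_sect y) = 1.
Proof. by apply: aug_pact; rewrite wp_val !addr0. Qed.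

(** [resS_htpS] leaves L^(k + l), and out of the object 0 the only power of L ending at [y] is
    [aug_sect y]. *)
Lemma homotopy_aug x1 y (b : rep (0 : C) y) : x1 = 0 + wp 1 ->
  b = rdiff false 0 x1 y (htpS 0 x1 y b) + aug_sect y *~ aug y b.
Proof.
move=> x1E.
apply: (rep_obj_ext (g := idfun) (h :=
  (rdiff false 0 x1 y \o htpS 0 x1 y) \+ (intmul (aug_sect y) \o aug y))).
move=> k l lN ey /=; rewrite resS_htpS // aug_pact // mulr1z.
rewrite [aug_sect y](_ : _ = pact y (k + l) 0 (rep_gen (0 : C))) ?subrK //.
by apply: (@eq_pact (rep _)) => //; rewrite wp_val -ey addr0 wpD.
Qed.

Lemma aug_surj : dsurj aug.
Proof.
move=> y n; exists (aug_sect y *~ n).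
by rewrite raddfMz aug_sectK intz.
Qed.

Lemma aug_rdiff_exact x1 : x1 = 0 + wp 1 -> dexact (rdiff false 0 x1) aug.
Proof.
move=> x1E; have aug0 : dmor_comp aug (rdiff false 0 x1) = 0.
  apply: rep_hom_ext; rewrite -/(eval_gen _) dmor_rdiff /diff /diffS.
  rewrite /eval_gen yoneda_gen.
  apply/eqP; rewrite subr_eq0; apply/eqP.
  by rewrite [LHS]const_int_pact ?[RHS]const_int_pact // x1E !addr0 // add0r.
pose t y (n : const_int C y) : rep (0 : C) y := aug_sect y *~ (n : int).
apply: (dexact_contraction aug0 (s := fun y => htpS 0 x1 y) (t := t)) => y.
  exact: mulr0z.
by move=> b; apply: homotopy_aug.
Qed.

(** * The assembled resolution and its cohomology *)

Definition deg_obj (n : nat) : C :=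
  if odd n then wp m *+ n./2 + wp 1 else wp m *+ n./2.

Lemma deg_objS n : ~~ odd n -> deg_obj n.+1 = deg_obj n + wp 1.
Proof. by move=> /negPf ne; rewrite /deg_obj /= uphalf_half ne. Qed.

Lemma deg_objSS n : ~~ odd n -> deg_obj n.+2 = wp m + deg_obj n.
Proof. by rewrite /deg_obj /= negbK => /negPf ->; rewrite mulrS. Qed.

Definition cyclic_resolution : proj_resolution (const_int C).
Proof.
exists (fun n => rep (deg_obj n))
  (fun n => rdiff (odd n) (deg_obj n) (deg_obj n.+1)) aug.
- by move=> n; apply: rep_projective.
- exact: aug_surj.
- exact: (@aug_rdiff_exact (deg_obj 1) erefl).
- move=> n; case: (boolP (odd n)) => [n_odd|n_even] /=.
    (* For odd degree the object [x0] of the exactness lemma sits one degree lower, so [n] becomes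
       its even predecessor. *)
    rewrite n_odd /=; case: n n_odd => // n /= n_even.
    apply: (@rdiff_exactTS (deg_obj n)); [exact: deg_objS | exact: deg_objSS |].
    by apply: deg_objS; rewrite /= negbK.
  rewrite (negPf n_even).
  by apply: rdiff_exactST; [apply: deg_objS | apply: deg_objSS].
Defined.

(** [I] is tested against [cobd_in] itself, so that degree 0, with its zero incoming map, is
    included. *)
Lemma Ext_cyclic A n (K I : zmodClosed (A (deg_obj n))) :
    (forall a, (a \in K) <-> diff (odd n) (deg_obj n.+1) a = 0) ->
    (forall h, (h \in imp (cobd_in cyclic_resolution A n)) <->
       (eval_gen h \in I)) ->
  zmod_isom (Ext cyclic_resolution A n) (subquot K I).
Proof.
move=> KP IP.
have kerE h : (h \in kerp (cobd cyclic_resolution A n)) <-> (eval_gen h \in K).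
  rewrite KP inE -dmor_rdiff; split=> [/eqP h0|h0].
    by rewrite [dmor_comp _ _]h0.
  by apply/eqP/rep_hom_ext; apply: h0.
apply: (@subquot_isom _ _ _ _ _ _ (@eval_gen _ _ A) (@yoneda _ _ A)).
- by move=> h /kerE.
- by move=> h /IP.
- by move=> a aK; apply/kerE; rewrite /eval_gen yoneda_gen.
- by move=> a aI; apply/IP; rewrite /eval_gen yoneda_gen.
- by move=> h _; rewrite [X in X - _]yonedaK subrr rpred0.
- by move=> a _; rewrite [X in X - _]yoneda_gen subrr rpred0.
Qed.

(** The variables [x], [y], [z] let [K] and [I] live over objects that equal [deg_obj] only
    propositionally, without transport. *)
Lemma Ext_cyclicS A n x y z (K I : zmodClosed (A y)) :
    deg_obj n = x -> deg_obj n.+1 = y -> deg_obj n.+2 = z ->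
    (forall a, (a \in K) <-> diff (~~ odd n) z a = 0) ->
    (forall a, (a \in I) <-> exists c : A x, diff (odd n) y c = a) ->
  zmod_isom (Ext cyclic_resolution A n.+1) (subquot K I).
Proof.
move=> ex ey ez; subst x y z => KP IP; apply: Ext_cyclic => // h.
rewrite IP; split=> [/asboolP[g <-]|[c hc]].
  by exists (eval_gen g); rewrite -dmor_rdiff.
apply/asboolP; exists (yoneda c); apply: rep_hom_ext.
rewrite -[RHS]hc -[LHS]/(eval_gen (dmor_comp (yoneda c) (rdiff (odd n) _ _))).
by rewrite dmor_rdiff /eval_gen yoneda_gen.
Qed.
End CyclicResolution.

Theorem theorem5p1 (m q : nat) (q_gt0 : (0 < q)%N) (mq_ge2 : (2 <= m + q)%N)
    (P : proj_resolution (const_int (cyc m q_gt0)))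
    (A : dmodule (cyc m q_gt0)) :
  zmod_isom (leech_cohomology P 0 A) (subg (invS A 0%R)) /\
  forall r : nat,
    zmod_isom (leech_cohomology P (2 * r + 1) A)
      (subquot (invT A (mulm_add1_gt0 q_gt0 mq_ge2 r))
               (imS A (wp m q_gt0 m *+ r)%R)) /\
    zmod_isom (leech_cohomology P (2 * r + 2) A)
      (subquot (invS A (wp m q_gt0 m *+ r.+1)%R)
               (imT A (mulm_add1_gt0 q_gt0 mq_ge2 r)
                      (mulmS_def q_gt0 mq_ge2 r))).
Proof.
have indep n := Ext_resolution_independent P (cyclic_resolution m q_gt0) A n.
have odd2 r : odd (2 * r) = false by rewrite oddM.
have half2 r : (2 * r)./2 = r by rewrite mul2n doubleK.
split=> [|r].
  apply: zmod_isom_trans (indep 0) _.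
  (* The zero subgroup, presented as an image so that degree 0 is a subquotient too. *)
  pose Z : zmodClosed (A 0%R) := imp (\0%R : {additive A 0%R -> A 0%R}).
  apply: (@zmod_isom_trans _ (subquot (invS A 0%R) Z)); last first.
    by apply/zmod_isom_sym/subquot0_isom => _ /asboolP[a <-].
  apply: Ext_cyclic => [a|h]; first exact: in_invS.
  split=> [/asboolP[g <-]|/asboolP[a h0]]; apply/asboolP; exists 0%R => //.
  by apply: rep_hom_ext; apply: h0.
have e0 : deg_obj m q_gt0 (2 * r) = (wp m q_gt0 m *+ r)%R.
  by rewrite /deg_obj odd2 half2.
have e1 : deg_obj m q_gt0 (2 * r).+1 = (wp m q_gt0 m *+ r + wp m q_gt0 1)%R.
  by rewrite deg_objS ?odd2 // e0.
have e2 : deg_obj m q_gt0 (2 * r).+2 = (wp m q_gt0 m *+ r.+1)%R.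
  by rewrite deg_objSS ?odd2 // e0 GRing.mulrS.
have e3 : deg_obj m q_gt0 (2 * r).+3 = (wp m q_gt0 m *+ r.+1 + wp m q_gt0 1)%R.
  by rewrite deg_objS /= ?odd2 // e2.
(* [invT] is defined with the target [wp m + wp x.-1], so the object of degree 2r + 2 is needed in
   that form as well. *)
have e2' := etrans e2 (mulmS_def q_gt0 mq_ge2 r).
split; [rewrite addn1 | rewrite addn2]; apply: zmod_isom_trans (indep _) _.
  apply: (Ext_cyclicS e0 e1 e2') => a; rewrite odd2; first exact: in_invT.
  exact: in_imS.
apply: (Ext_cyclicS e1 e2 e3) => a; rewrite /= odd2; first exact: in_invS.
exact: in_imT.
Qed.
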